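(* Let $D$ be a planar knotoid diagram and let $D^*$ be the mirror image of $D$. Then (1) $B_{D^*}(x,v)=B_D(x^{-1},v^{-1})$ and $C_{D^*}(x,v)=C_D(x,v)$; (2) $\widetilde{B}_{D^*}(x,v)=\widetilde{B}_D(x^{-1},v)$ and $\widetilde{C}_{D^*}(x,v)=\widetilde{C}_D(x,v^{-1})$.
   Context: **Knotoid diagrams.** A planar knotoid diagram $D$ is a generic immersion $f:[0,1]\to\mathbb{R}^2$ (its only multiple points are finitely many transverse double points, called crossings, distinct from $f(0)$ and $f(1)$) with over/under information at each crossing; it is oriented from its leg $f(0)$ to its head $f(1)$. $C(D)$ is the set of crossings. The sign $\mathrm{sgn}(c)$ is $+1$ if (tangent of overstrand, tangent of understrand) is a positively oriented basis of $\mathbb{R}^2$, and $-1$ otherwise. The mirror image $D^*$ is obtained from $D$ by exchanging over and under at every crossing (same underlying oriented curve). **Coloring number.** The arcs of $D$ are the closures of the components of $D\setminus C(D)$. A Cheng coloring assigns an integer to each arc so that, travelling along $D$, at each passage through a crossing (over or under) the label increases by $1$ if the curve crosses the other strand from right to left (with respect to that other strand's orientation) and decreases by $1$ if from left to right. It is unique up to an additive constant. At a crossing $c$, let $a$ be the label of the incoming arc of the strand crossing the other one from right to left (its outgoing arc has label $a+1$), and $b$ the label of the outgoing arc of the other strand (its incoming arc has label $b+1$). Then $u(c)=a-b$. **Gauss diagram.** $G(D)$ is the interval $[0,1]$ drawn as a counterclockwise oriented arc of a circle (with a gap between head and leg), with one chord for each crossing $c$ (also denoted $c$) joining its two preimages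 and oriented from the over-preimage to the under-preimage; the starting point of the chord carries the sign $\mathrm{sgn}(c)$ and the ending point carries $-\mathrm{sgn}(c)$. For a chord $c$, $r(c)$ (resp. $l(c)$) is the set of chords $e$ crossing $c$ and pointing to the right (resp. left) hand side of $c$. The lead side of $c$ is the side containing the leg and the head; $\lambda(c)$ is the set of chords crossing $c$ and pointing to the lead side of $c$, and $\rho(c)$ the set of chords crossing $c$ and pointing from the lead side to the other side. The degree is $d(c)=\sum_{e\in r(c)}\mathrm{sgn}(e)-\sum_{e\in l(c)}\mathrm{sgn}(e)$, and the intersection index $i(c)$ is the sum of the signs of the chord endpoints on the lead side of $c$, the endpoints of $c$ excluded. **Index functions.** Let $R_m=\mathbb{Z}[v,v^{-1}]/(v^m-1)$ for $m\ge 0$ (so $R_0=\mathbb{Z}[v,v^{-1}]$). For a chord $c$, $\phi_c:\mathbb{Z}\to\{0,1,\dots,|d(c)|-1\}$ is reduction modulo $|d(c)|$ (the identity of $\mathbb{Z}$ if $d(c)=0$). In $R_{|d(c)|}$ define $g_c(v)=\sum_{e\in r(c)}\mathrm{sgn}(e)v^{\phi_c(d(e))}-\sum_{e\in l(c)}\mathrm{sgn}(e)v^{\phi_c(-d(e))}$, $h_c(v)=\sum_{e\in\rho(c)}\mathrm{sgn}(e)v^{\phi_c(d(e))}-\sum_{e\in\lambda(c)}\mathrm{sgn}(e)v^{\phi_c(-d(e))}$, $\widetilde g_c(v)=\sum_{e\in r(c)}\mathrm{sgn}(e)v^{\phi_c(i(e))}-\sum_{e\in l(c)}\mathrm{sgn}(e)v^{\phi_c(-i(e))}$,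 $\widetilde h_c(v)=\sum_{e\in\rho(c)}\mathrm{sgn}(e)v^{\phi_c(i(e))}-\sum_{e\in\lambda(c)}\mathrm{sgn}(e)v^{\phi_c(-i(e))}$. **4-phases functions.** $B_D(x,v)=\sum_{c\in C(D)}u(c)x^{g_c(v)}$, $C_D(x,v)=\sum_{c\in C(D)}u(c)x^{h_c(v)}$, $\widetilde B_D(x,v)=\sum_{c\in C(D)}u(c)x^{\widetilde g_c(v)}$, $\widetilde C_D(x,v)=\sum_{c\in C(D)}u(c)x^{\widetilde h_c(v)}$, regarded as elements of the free abelian group on formal symbols $x^p$ with $p\in\bigsqcup_{m\ge0}R_m$. Replacing $x$ by $x^{-1}$ sends $x^p$ to $x^{-p}$; replacing $v$ by $v^{-1}$ sends $x^{p(v)}$ to $x^{p(v^{-1})}$ (with $p(v^{-1})$ taken in the same $R_m$). *)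

(* Defs.v *)
From HB Require Import structures.
From mathcomp Require Import all_boot all_order all_algebra.
From mathcomp Require Import all_classical all_reals all_analysis.
From mathcomp Require Import finmap generic_quotient ring_quotient.
From mathcomp.multinomials Require Import freeg.

Set Implicit Arguments.
Unset Strict Implicit.
Unset Printing Implicit Defensive.
Import Order.TTheory GRing.Theory Num.Theory.
Import numFieldNormedType.Exports.

Local Open Scope classical_set_scope.
Local Open Scope quotient_scope.
Local Open Scope ring_scope.

(* Positive iff (u, v) is a positively oriented basis of the plane. *)
Definition orient {R : realType} (u v : 'rV[R]_2) : R :=
  \det (col_mx u v : 'M[R]_2).

(* A double point is identified with its two preimages (s, t), s < t. *)
Definition double_points {R : realType} (f : R -> 'rV[R]_2) : set (R * R) :=
  [set c | [/\ 0 <= c.1, c.1 < c.2, c.2 <= 1 & f c.1 = f c.2]].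

(* As usual, a smooth map on the closed interval [0, 1] is one that extends
   smoothly to the real line.  The field curve is such an extension; its values
   outside [0, 1] play no role. *)
Record knotoid_diagram (R : realType) := KnotoidDiagram {
  curve :> R -> 'rV[R]_2;
  (* at a double point (s, t): true iff the passage at time s is the over one;
     the values elsewhere are irrelevant *)
  first_over : R * R -> bool;
  curve_smooth : forall n t, derivable (derive1n n curve) t 1;
  curve_immersion : forall t, 0 <= t <= 1 -> derive1 curve t != 0;
  curve_no_triple : forall s t w, 0 <= s <= 1 -> 0 <= t <= 1 -> 0 <= w <= 1 ->
    curve s = curve t -> curve t = curve w -> [|| s == t, t == w | s == w];
  curve_finite : finite_set (double_points curve);
  curve_transverse : forall c, double_points curve c ->
    orient (derive1 curve c.1) (derive1 curve c.2) != 0;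
  curve_endpoints : forall c, double_points curve c ->
    curve c.1 != curve 0 /\ curve c.1 != curve 1
}.

Section Diagram.
Context {R : realType}.
Implicit Types (D : knotoid_diagram R) (c e : R * R) (s t : R).

Definition mirror D : knotoid_diagram R :=
  KnotoidDiagram (fun c => ~~ first_over D c) (@curve_smooth R D)
    (@curve_immersion R D) (@curve_no_triple R D) (@curve_finite R D)
    (@curve_transverse R D) (@curve_endpoints R D).

Definition crossings D : set (R * R) := double_points D.

Definition over_time D c : R := if first_over D c then c.1 else c.2.
Definition under_time D c : R := if first_over D c then c.2 else c.1.

Definition sgn D c : int :=
  if 0 < orient (derive1 D (over_time D c)) (derive1 D (under_time D c)) then 1 else -1.

(* The strand through time t crosses the strand through time s from right to
   left with respect to the latter's orientation. *)
Definition right_to_left D s t : bool := 0 < orient (derive1 D s) (derive1 D t).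

Definition passages D : set R :=
  [set t | exists2 c, crossings D c & t = c.1 \/ t = c.2].

(* The arcs are numbered 0, 1, 2, ... from the leg to the head, consecutive
   arcs being separated by one passage (over or under) through a crossing. *)
Definition arc_in D t : nat :=
  let earlier := passages D `&` [set s | s < t] in #|` fset_set earlier|%N.
Definition arc_out D t : nat := (arc_in D t).+1.

Definition cheng_step D s t : int := if right_to_left D s t then 1 else -1.

Definition cheng_coloring D (k : nat -> int) : Prop :=
  forall c, crossings D c ->
    k (arc_out D c.1) = k (arc_in D c.1) + cheng_step D c.2 c.1 /\
    k (arc_out D c.2) = k (arc_in D c.2) + cheng_step D c.1 c.2.

Lemma crossings_inj D c e : crossings D c -> crossings D e ->
  [|| c.1 == e.1, c.1 == e.2, c.2 == e.1 | c.2 == e.2] -> c = e.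
Proof.
case: c e => [s t] [s' t'] [/= s0 st t1 fst] [/= s'0 st' t'1 fst'] H.
have I (x z : R) : 0 <= x -> x < z -> z <= 1 -> 0 <= x <= 1 /\ 0 <= z <= 1.
  by move=> x0 xz z1; rewrite x0 z1 (ltW (lt_le_trans xz z1)) (ltW (le_lt_trans x0 xz)).
have [Is It] := I _ _ s0 st t1.
have [Is' It'] := I _ _ s'0 st' t'1.
have nst : (s == t) = false by rewrite lt_eqF.
have nst' : (s' == t') = false by rewrite lt_eqF.
have T := @curve_no_triple R D.
case/or4P: H => /eqP E.
- subst s'; have /or3P[|/eqP F|/eqP -> //] := T t s t' It Is It' (esym fst) fst'.
    by rewrite eq_sym nst.
  by rewrite F ltxx in st'.
- subst t'; have /or3P[|/eqP F|] := T t s s' It Is Is' (esym fst) (esym fst').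
  + by rewrite eq_sym nst.
  + by rewrite F ltxx in st'.
  + by move=> /eqP F; move: (lt_trans st' st); rewrite F ltxx.
- subst s'; have /or3P[|/eqP F|] := T s t t' Is It It' fst fst'.
  + by rewrite nst.
  + by rewrite F ltxx in st'.
  + by move=> /eqP F; move: (lt_trans st st'); rewrite F ltxx.
- subst t'; have /or3P[|/eqP F|/eqP -> //] := T s t s' Is It Is' fst (esym fst').
    by rewrite nst.
  by rewrite F ltxx in st'.
Qed.

Lemma passages_finite D : finite_set (passages D).
Proof.
apply: (@sub_finite_set _ _ (fst @` crossings D `|` snd @` crossings D)).
  by move=> t [c Cc [->|->]]; [left|right]; exists c.
by rewrite finite_setU; split; apply: finite_image; exact: curve_finite.
Qed.

Lemma arc_in_lt D s t : passages D s -> s < t -> (arc_in D s < arc_in D t)%N.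
Proof.
move=> Ps st; apply: fproper_ltn_card; rewrite fproperE.
have F u : finite_set (passages D `&` [set s | s < u]).
  by apply: sub_finite_set (passages_finite D) => x [].
apply/andP; split.
  apply/fsubsetP => x; rewrite !in_fset_set // => /set_mem[Px /= xs].
  by apply/mem_set; split => //; exact: lt_trans xs st.
apply/fsubsetPn; exists s; rewrite in_fset_set //; first exact/mem_set.
by apply/negP => /set_mem[_ /=]; rewrite ltxx.
Qed.

Lemma arc_in_inj D s t : passages D s -> passages D t ->
  (arc_in D s == arc_in D t) = (s == t).
Proof.
move=> Ps Pt; case: (ltgtP s t) => [st|ts|->]; last by rewrite eqxx.
  by rewrite ltn_eqF // arc_in_lt.
by rewrite gtn_eqF // arc_in_lt.
Qed.

Lemma arc_in_lt_out D s t : passages D s -> passages D t -> s != t ->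
  (arc_in D s < arc_out D t)%N = (arc_in D s < arc_in D t)%N.
Proof.
move=> Ps Pt /negPf nst; move: (arc_in_inj Ps Pt); rewrite nst /arc_out.
by move: (arc_in D s) (arc_in D t) => m n nmn; rewrite ltnS leq_eqVlt nmn.
Qed.

Lemma cheng_coloring_exists D : exists k, cheng_coloring D k.
Proof.
pose F j c := (arc_in D c.1 < j)%N%:R * cheng_step D c.2 c.1 +
  (arc_in D c.2 < j)%N%:R * cheng_step D c.1 c.2.
pose k j := \sum_(c <- fset_set (crossings D)) F j c.
have FC := @curve_finite R D : finite_set (crossings D).
have Fne c e t : crossings D c -> crossings D e -> t = c.1 \/ t = c.2 -> e != c ->
    F (arc_out D t) e = F (arc_in D t) e.
  move=> Cc Ce tc nec; have Pt : passages D t by exists c.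
  have P1 : passages D e.1 by exists e => //; left.
  have P2 : passages D e.2 by exists e => //; right.
  have [|] := boolP [|| e.1 == c.1, e.1 == c.2, e.2 == c.1 | e.2 == c.2].
    by move=> /(crossings_inj Ce Cc) E; rewrite E eqxx in nec.
  rewrite !negb_or => /and4P[n11 n12 n21 n22].
  by rewrite /F !arc_in_lt_out //; case: tc => ->.
have kS c t : crossings D c -> t = c.1 \/ t = c.2 ->
    k (arc_out D t) - k (arc_in D t) = F (arc_out D t) c - F (arc_in D t) c.
  move=> Cc tc; rewrite /k -sumrB (bigD1_seq c) ?fset_uniq ?in_fset_set ?mem_set //=.
  rewrite big_seq_cond big1 ?addr0 // => e /andP[].
  by rewrite in_fset_set // => /set_mem Ce nec; rewrite (Fne c) // subrr.
exists k => c Cc.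
have P1 : passages D c.1 by exists c => //; left.
have P2 : passages D c.2 by exists c => //; right.
have lt12 : (arc_in D c.1 < arc_in D c.2)%N by apply: arc_in_lt => //; case: Cc.
have F1 : F (arc_out D c.1) c - F (arc_in D c.1) c = cheng_step D c.2 c.1.
  rewrite /F /arc_out; move: lt12 (cheng_step _ _ _) (cheng_step _ _ _).
  move: (arc_in D c.1) (arc_in D c.2) => m n mn a b.
  have -> : (n < m.+1)%N = false by rewrite ltnS leqNgt mn.
  have -> : (n < m)%N = false by rewrite ltnNge (ltnW mn).
  by rewrite ltnSn ltnn mulr0n mulr1n !mul0r mul1r add0r addrK.
have F2 : F (arc_out D c.2) c - F (arc_in D c.2) c = cheng_step D c.1 c.2.
  rewrite /F /arc_out; move: lt12 (cheng_step _ _ _) (cheng_step _ _ _).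
  move: (arc_in D c.1) (arc_in D c.2) => m n mn a b.
  have -> : (m < n.+1)%N = true by rewrite ltnS ltnW.
  by rewrite mn ltnSn ltnn mulr0n mulr1n mul0r !mul1r addr0 addrAC subrr add0r.
split; apply/eqP; rewrite addrC -subr_eq; apply/eqP.
  by rewrite -F1; apply: kS => //; left.
by rewrite -F2; apply: kS => //; right.
Qed.

Definition ucol D (k : nat -> int) c : int :=
  if right_to_left D c.2 c.1 then k (arc_in D c.1) - k (arc_out D c.2)
  else k (arc_in D c.2) - k (arc_out D c.1).

(* Points of the Gauss diagram strictly between a and b when travelling
   counterclockwise from a to b; if b < a one goes through the gap between the
   head 1 and the leg 0. *)
Definition ccw_arc (a b : R) : set R :=
  [set t | if a < b then a < t /\ t < b else a < t \/ t < b].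

(* On a counterclockwise circle, the counterclockwise arc from the starting
   point of a directed chord to its ending point is on its right. *)
Definition right_side D c : set R := ccw_arc (over_time D c) (under_time D c).
Definition left_side D c : set R := ccw_arc (under_time D c) (over_time D c).
Definition lead_side c : set R := ccw_arc c.2 c.1.
Definition nonlead_side c : set R := ccw_arc c.1 c.2.

Definition chords_from_to D (A B : set R) : set (R * R) :=
  [set e | [/\ crossings D e, A (over_time D e) & B (under_time D e)]].

Definition r_chords D c := chords_from_to D (left_side D c) (right_side D c).
Definition l_chords D c := chords_from_to D (right_side D c) (left_side D c).
Definition lambda_chords D c := chords_from_to D (nonlead_side c) (lead_side c).
Definition rho_chords D c := chords_from_to D (lead_side c) (nonlead_side c).

Definition degree D c : int :=
  \sum_(e \in r_chords D c) sgn D e - \sum_(e \in l_chords D c) sgn D e.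

(* A chord e carries the sign sgn e at its starting (over) point and - sgn e at
   its ending (under) point.  The endpoints of c itself are automatically
   excluded, since the sides of c are open. *)
Definition intersection_index D c : int :=
  \sum_(e \in crossings D `&` [set e | lead_side c (over_time D e)]) sgn D e +
  \sum_(e \in crossings D `&` [set e | lead_side c (under_time D e)]) - sgn D e.

End Diagram.

(* The additive map << k >> |-> << f k >> between free abelian groups. *)
Definition freeg_map (K K' : choiceType) (f : K -> K') :
  {freeg K / int} -> {freeg K' / int} := fglift (fun k => << f k >>).

Fact freeg_map_is_additive (K K' : choiceType) (f : K -> K') :
  zmod_morphism (freeg_map f).
Proof. exact: lift_is_additive. Qed.
HB.instance Definition _ (K K' : choiceType) (f : K -> K') :=
  GRing.isZmodMorphism.Build _ _ (freeg_map f) (freeg_map_is_additive f).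

Lemma freeg_mapU (K K' : choiceType) (f : K -> K') z k :
  freeg_map f << z *g k >> = << z *g f k >>.
Proof.
by rewrite /freeg_map liftU; apply/eqP/freeg_eqP => x; rewrite coeffZ !coeffU mul1r.
Qed.

Lemma freeg_map_comp (K K' K'' : choiceType) (f : K' -> K'') (g : K -> K') p :
  freeg_map f (freeg_map g p) = freeg_map (f \o g) p.
Proof.
rewrite -(freeg_sumE p) !raddf_sum /=.
by apply: eq_bigr => k _; rewrite !freeg_mapU.
Qed.

Lemma eq_freeg_map (K K' : choiceType) (f g : K -> K') :
  f =1 g -> freeg_map f =1 freeg_map g.
Proof. by move=> /funext ->. Qed.

(* Z[v, v^-1], with << n >> standing for v^n.  Only its additive structure, the
   multiplication by v^m and the substitution of v^-1 for v are needed. *)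
Notation laurent := {freeg int / int}.

Definition mul_vn (m : nat) : laurent -> laurent :=
  freeg_map (fun n : int => m%:Z + n).
HB.instance Definition _ m := GRing.Additive.on (mul_vn m).

Definition laurent_vinv : laurent -> laurent := freeg_map (fun n : int => - n).
HB.instance Definition _ := GRing.Additive.on laurent_vinv.

(* The ideal (v^m - 1). *)
Definition vm1_ideal (m : nat) : {pred laurent} :=
  [pred p | `[< exists w : laurent, p = mul_vn m w - w >]].

Fact vm1_ideal_zmod_closed m : zmod_closed (vm1_ideal m).
Proof.
split=> [|p q].
  by apply/asboolP; exists 0; rewrite raddf0 subr0.
move=> /asboolP[w ->] /asboolP[w' ->]; apply/asboolP; exists (w - w').
by rewrite (raddfB (mul_vn m)) !opprB [w' - mul_vn m w']addrC addrACA
  [- w + w']addrC.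
Qed.
HB.instance Definition _ m :=
  GRing.isZmodClosed.Build laurent (vm1_ideal m) (vm1_ideal_zmod_closed m).

(* R_m = Z[v, v^-1] / (v^m - 1), as an additive group. *)
Definition Rv (m : nat) := Quotient.quot (vm1_ideal m).
HB.instance Definition _ m := GRing.Zmodule.on (Rv m).
HB.instance Definition _ m := Quotient.on (Rv m).

Definition Rv_vinv m (p : Rv m) : Rv m := lift_op1 (Rv m) laurent_vinv p.

(* v ^ phi n, where phi is reduction modulo m (and the identity if m = 0) *)
Definition vpow m (n : int) : Rv m := \pi_(Rv m) << (n %% m)%Z >>.

Lemma pi_Rv_vinv m (p : laurent) :
  Rv_vinv (\pi_(Rv m) p) = \pi_(Rv m) (laurent_vinv p).
Proof.
rewrite /Rv_vinv; unlock; apply/eqP; rewrite -Quotient.idealrBE -raddfB.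
have : repr (\pi_(Rv m) p) - p \in vm1_ideal m.
  by rewrite Quotient.idealrBE reprK.
move=> /asboolP[w ->]; apply/asboolP.
exists (- freeg_map (fun n => - m%:Z - n) w).
have -> : mul_vn m (- freeg_map (fun n => - m%:Z - n) w) = - laurent_vinv w.
  rewrite (raddfN (mul_vn m)); congr (- _); rewrite [LHS]freeg_map_comp.
  by apply: eq_freeg_map => n /=; rewrite addrA subrr add0r.
rewrite (raddfB laurent_vinv) opprK addrC; congr (_ + _).
rewrite [LHS]freeg_map_comp.
by apply: eq_freeg_map => n /=; rewrite opprD.
Qed.

(* The exponents of x: the disjoint union of the R_m. *)
Notation exponent := {m : nat & Rv m}.

Notation xpoly := {freeg exponent / int}.

Definition subst_xinv : xpoly -> xpoly :=
  freeg_map (fun p : exponent => Tagged Rv (- tagged p)).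

Definition subst_vinv : xpoly -> xpoly :=
  freeg_map (fun p : exponent => Tagged Rv (Rv_vinv (tagged p))).

Section FourPhases.
Context {R : realType}.
Implicit Types (D : knotoid_diagram R) (c : R * R) (k : nat -> int).

Definition index_poly D m (P N : set (R * R)) (idx : R * R -> int) : Rv m :=
  \sum_(e \in P) vpow m (idx e) *~ sgn D e -
  \sum_(e \in N) vpow m (- idx e) *~ sgn D e.

Definition g_poly D c : Rv `|degree D c|%N :=
  index_poly D _ (r_chords D c) (l_chords D c) (degree D).
Definition h_poly D c : Rv `|degree D c|%N :=
  index_poly D _ (rho_chords D c) (lambda_chords D c) (degree D).
Definition gt_poly D c : Rv `|degree D c|%N :=
  index_poly D _ (r_chords D c) (l_chords D c) (intersection_index D).
Definition ht_poly D c : Rv `|degree D c|%N :=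
  index_poly D _ (rho_chords D c) (lambda_chords D c) (intersection_index D).

Definition four_phases D k (p : forall c, Rv `|degree D c|%N) : xpoly :=
  \sum_(c \in crossings D) << ucol D k c *g Tagged Rv (p c) >>.

Definition B_fun D k : xpoly := four_phases k (g_poly D).
Definition C_fun D k : xpoly := four_phases k (h_poly D).
Definition Bt_fun D k : xpoly := four_phases k (gt_poly D).
Definition Ct_fun D k : xpoly := four_phases k (ht_poly D).

End FourPhases.

(* Main.v *)
(** Exchanging over and under reverses every chord of the Gauss diagram and
negates its sign.  Reversal swaps both the endpoints of a chord [e] and the two
sides of [c], so [r(c)] and [l(c)] are unchanged, whereas the lead side of [c]
does not depend on the orientation of [c], so [rho(c)] and [lambda(c)] are
exchanged.  Hence [d] changes sign, [i] is invariant, and the four identities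
follow by comparing exponents.  The Cheng coloring ignores the over/under
information, and its uniqueness up to a constant makes the weights [u(c)]
independent of the colorings chosen for [D] and its mirror image. *)
Require Import Defs.
From HB Require Import structures.
From mathcomp Require Import all_boot all_order all_algebra.
From mathcomp Require Import all_classical all_reals all_analysis.
From mathcomp Require Import perm finmap generic_quotient ring_quotient.
From mathcomp.multinomials Require Import freeg.

Set Implicit Arguments.
Unset Strict Implicit.
Unset Printing Implicit Defensive.
Import Order.TTheory GRing.Theory Num.Theory.

Local Open Scope classical_set_scope.
Local Open Scope quotient_scope.
Local Open Scope ring_scope.

(** * Finite sums and additive maps *)

Lemma raddf_fsum (U V : zmodType) (f : {additive U -> V}) (I : choiceType)
    (P : set I) (F : I -> U) : finite_set P ->
  f (\sum_(i \in P) F i) = \sum_(i \in P) f (F i).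
Proof. by move=> fP; rewrite !fsbig_finite // raddf_sum. Qed.

Lemma fsumrN (V : zmodType) (I : choiceType) (P : set I) (F : I -> V) :
  finite_set P -> \sum_(i \in P) - F i = - \sum_(i \in P) F i.
Proof. by move=> fP; rewrite (raddf_fsum (@GRing.opp V)). Qed.

Lemma freeg_map_id (K : choiceType) : @freeg_map K K id =1 id.
Proof.
move=> p; rewrite -[in RHS](freeg_sumE p) -[in LHS](freeg_sumE p) raddf_sum /=.
by apply: eq_bigr => x _; rewrite freeg_mapU.
Qed.

(** * Powers of [v] in [Rv m] *)

Section Exponents.
Variable m : nat.

Lemma pi_vD (n : int) :
  \pi_(Rv m) << m%:Z + n >> = \pi_(Rv m) (<< n >> : laurent).
Proof.
apply/eqP; rewrite -Quotient.idealrBE; apply/asboolP; exists << n >>.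
by rewrite /mul_vn freeg_mapU.
Qed.

Lemma pi_vDMn (n : int) (q : nat) :
  \pi_(Rv m) << m%:Z *+ q + n >> = \pi_(Rv m) (<< n >> : laurent).
Proof.
by elim: q => [|q IHq]; rewrite ?mulr0n ?add0r // mulrS -addrA pi_vD.
Qed.

Lemma pi_vDMz (n q : int) :
  \pi_(Rv m) << q * m%:Z + n >> = \pi_(Rv m) (<< n >> : laurent).
Proof.
rewrite mulrC -mulrzz; case: q => q; first exact: pi_vDMn.
(* A negative multiple is undone by adding [q.+1] copies of [m] to the exponent. *)
by rewrite -[LHS](pi_vDMn _ q.+1) [_ + (_ + n)]addNKr.
Qed.

(** Since v^m = 1, reducing the exponent does not change the class; exponents can then be negated
    without tracking remainders. *)
Lemma vpowE (n : int) : vpow m n = \pi_(Rv m) << n >>.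
Proof. by rewrite [in RHS](divz_eq n m) pi_vDMz. Qed.

Lemma Rv_vinv_vpow (n : int) : Rv_vinv (vpow m n) = vpow m (- n).
Proof. by rewrite !vpowE pi_Rv_vinv /laurent_vinv freeg_mapU. Qed.

Lemma Rv_vinv_is_additive : zmod_morphism (@Rv_vinv m).
Proof.
move=> p q; rewrite -(reprK p) -(reprK q) -raddfB !pi_Rv_vinv -raddfB.
by rewrite (raddfB laurent_vinv).
Qed.

End Exponents.

HB.instance Definition _ m :=
  GRing.isZmodMorphism.Build _ _ (@Rv_vinv m) (@Rv_vinv_is_additive m).

(** * Gauss diagram of the mirror image *)

Section Mirror.
Variables (R : realType) (D : knotoid_diagram R).
Implicit Types (c e : R * R) (k : nat -> int) (m : nat).

Lemma over_time_mirror c : over_time (mirror D) c = under_time D c.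
Proof. by rewrite /over_time /under_time /=; case: first_over. Qed.

Lemma under_time_mirror c : under_time (mirror D) c = over_time D c.
Proof. by rewrite /over_time /under_time /=; case: first_over. Qed.

Lemma orientC (u v : 'rV[R]_2) : orient v u = - orient u v.
Proof.
pose i0 : 'I_(1 + 1) := lshift 1 0; pose i1 : 'I_(1 + 1) := rshift 1 0.
(* Exchanging the rows multiplies by the matrix of a transposition, of determinant -1. *)
have E : col_mx v u = xrow i0 i1 (col_mx u v).
  apply/matrixP => i j.
  have [l ->|l ->] := split_ordP i; rewrite (ord1 l).
    by rewrite col_mxEu [RHS]mxE tpermL col_mxEd.
  by rewrite col_mxEd [RHS]mxE tpermR col_mxEu.
rewrite /orient [X in \det X]E xrowE det_mulmx det_perm odd_tperm.
by rewrite expr1 mulN1r.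
Qed.

(** Transversality matters here: [sgn] defaults to -1 on a zero determinant, where both diagrams
    would get the same sign. *)
Lemma sgn_mirror c : crossings D c -> sgn (mirror D) c = - sgn D c.
Proof.
move=> Cc; rewrite /sgn over_time_mirror under_time_mirror.
rewrite -[curve (mirror D)]/(curve D).
set u := derive1 D (over_time D c); set v := derive1 D (under_time D c).
have uv : orient u v != 0.
  move: (curve_transverse Cc); rewrite /u /v /over_time /under_time.
  case: first_over => T; first exact: T.
  by rewrite orientC oppr_eq0; exact: T.
rewrite (orientC u v) oppr_gt0.
by case: ltgtP uv; rewrite ?opprK.
Qed.

Lemma chords_from_to_mirror A B :
  chords_from_to (mirror D) A B = chords_from_to D B A.
Proof.
apply/seteqP; split=> e; rewrite /chords_from_to /= over_time_mirror
  under_time_mirror => -[]; by split.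
Qed.

Lemma right_side_mirror c : right_side (mirror D) c = left_side D c.
Proof. by rewrite /right_side over_time_mirror under_time_mirror. Qed.

Lemma left_side_mirror c : left_side (mirror D) c = right_side D c.
Proof. by rewrite /left_side over_time_mirror under_time_mirror. Qed.

Lemma r_chords_mirror c : r_chords (mirror D) c = r_chords D c.
Proof.
by rewrite /r_chords chords_from_to_mirror right_side_mirror left_side_mirror.
Qed.

Lemma l_chords_mirror c : l_chords (mirror D) c = l_chords D c.
Proof.
by rewrite /l_chords chords_from_to_mirror right_side_mirror left_side_mirror.
Qed.

Lemma rho_chords_mirror c : rho_chords (mirror D) c = lambda_chords D c.
Proof. exact: chords_from_to_mirror. Qed.

Lemma lambda_chords_mirror c : lambda_chords (mirror D) c = rho_chords D c.
Proof. exact: chords_from_to_mirror. Qed.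

Lemma sub_crossings_finite P : P `<=` crossings D -> finite_set P.
Proof. by move=> sP; apply: sub_finite_set sP _; exact: curve_finite. Qed.

Lemma chords_from_to_sub A B : chords_from_to D A B `<=` crossings D.
Proof. by move=> e []. Qed.

Lemma fsum_sgn_mirror P : P `<=` crossings D ->
  \sum_(e \in P) sgn (mirror D) e = - \sum_(e \in P) sgn D e.
Proof.
move=> sP; rewrite -fsumrN; last exact: sub_crossings_finite.
by apply: eq_fsbigr => e /set_mem Pe; rewrite sgn_mirror //; exact: sP.
Qed.

Lemma degree_mirror c : degree (mirror D) c = - degree D c.
Proof.
rewrite /degree r_chords_mirror l_chords_mirror [RHS]opprD.
by congr (_ - _); apply: fsum_sgn_mirror; exact: chords_from_to_sub.
Qed.

(** Every chord endpoint keeps its sign, because its over/under role and the sign of its chord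
    change together; the two sums are merely exchanged. *)
Lemma intersection_index_mirror c :
  intersection_index (mirror D) c = intersection_index D c.
Proof.
have Eo : [set e | lead_side c (over_time (mirror D) e)] =
    [set e | lead_side c (under_time D e)].
  by apply/funext => e /=; rewrite over_time_mirror.
have Eu : [set e | lead_side c (under_time (mirror D) e)] =
    [set e | lead_side c (over_time D e)].
  by apply/funext => e /=; rewrite under_time_mirror.
rewrite /intersection_index Eo Eu [LHS]addrC.
congr (_ + _); apply: eq_fsbigr => e /set_mem[Ce _]; rewrite sgn_mirror //.
by rewrite opprK.
Qed.

(** * Symmetries of the index polynomials *)

Section IndexPoly.
Variables (m : nat) (P N : set (R * R)).
Hypotheses (sP : P `<=` crossings D) (sN : N `<=` crossings D).
Implicit Type idx : R * R -> int.

Lemma index_poly_mirror idx :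
  index_poly (mirror D) m P N idx = - index_poly D m P N idx.
Proof.
rewrite /index_poly [RHS]opprB [RHS]addrC; congr (_ + _).
  rewrite -[RHS]fsumrN; last exact: sub_crossings_finite.
  by apply: eq_fsbigr => e /set_mem /sP Ce; rewrite sgn_mirror // mulrNz.
rewrite -[LHS]fsumrN; last exact: sub_crossings_finite.
by apply: eq_fsbigr => e /set_mem /sN Ce; rewrite sgn_mirror // mulrNz opprK.
Qed.

(** Absorbs the exchange of [rho_chords] and [lambda_chords]. *)
Lemma index_polyN idx :
  index_poly D m N P (\- idx) = - index_poly D m P N idx.
Proof.
rewrite /index_poly opprB; congr (_ - _).
by apply: eq_fsbigr => e _ /=; rewrite opprK.
Qed.

Lemma Rv_vinv_index_poly idx :
  Rv_vinv (index_poly D m P N idx) = index_poly D m P N (\- idx).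
Proof.
rewrite /index_poly (raddfB (@Rv_vinv m)).
rewrite !(raddf_fsum (@Rv_vinv m)); try exact: sub_crossings_finite.
congr (_ - _); apply: eq_fsbigr => e _.
  by rewrite (raddfMz (@Rv_vinv m)) /= Rv_vinv_vpow.
by rewrite (raddfMz (@Rv_vinv m)) /= Rv_vinv_vpow.
Qed.

End IndexPoly.

(** * Uniqueness of Cheng colorings and the weights *)

Lemma arc_in_surj u j : (j < arc_in D u)%N ->
  exists2 t, passages D t & arc_in D t = j.
Proof.
move=> ju; set E := fset_set (passages D `&` [set s | s < u]).
have EP x : x \in E -> passages D x /\ x < u.
  rewrite in_fset_set; first by move=> /set_mem.
  by apply: sub_finite_set (@passages_finite R D) => y [].
(* Pigeonhole: the passages before [u] have pairwise distinct arc numbers below [arc_in D u], and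
   there are [arc_in D u] of them, so every such number occurs. *)
have [|||_ eqE] :=
    @uniq_min_size _ [seq arc_in D x | x <- E] (iota 0 (arc_in D u)).
- rewrite map_inj_in_uniq ?fset_uniq // => x y /EP[Px _] /EP[Py _] /eqP.
  by rewrite arc_in_inj // => /eqP.
- by move=> _ /mapP[x /EP[Px xu] ->]; rewrite mem_iota arc_in_lt.
- by rewrite size_iota size_map.
have : j \in iota 0 (arc_in D u) by rewrite mem_iota.
by rewrite -eqE => /mapP[t /EP[Pt _] ->]; exists t.
Qed.

Lemma cheng_coloring_out k k' t :
  cheng_coloring D k -> cheng_coloring D k' -> passages D t ->
  k' (arc_out D t) - k (arc_out D t) = k' (arc_in D t) - k (arc_in D t).
Proof.
move=> hk hk' [c Cc tc]; have [e1 e2] := hk c Cc; have [e1' e2'] := hk' c Cc.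
by case: tc => ->; rewrite ?e1 ?e1' ?e2 ?e2' opprD addrACA subrr addr0.
Qed.

(** Induction along the curve: arc [n.+1] leaves a passage entered by arc [n], where both colorings
    take the same step. *)
Lemma cheng_coloring_unique k k' t :
  cheng_coloring D k -> cheng_coloring D k' ->
  k' (arc_in D t) - k (arc_in D t) = k' 0%N - k 0%N.
Proof.
move=> hk hk'; move En: (arc_in D t) => n.
elim: n t En => [//|n IHn] t En.
have [|s Ps Es] := @arc_in_surj t n; first by rewrite En.
by rewrite -(IHn s Es) -Es -cheng_coloring_out // /arc_out Es.
Qed.

Lemma ucol_mirror k k' c :
  cheng_coloring D k -> cheng_coloring (mirror D) k' -> crossings D c ->
  ucol (mirror D) k' c = ucol D k c.
Proof.
move=> hk hk' Cc.
have P1 : passages D c.1 by exists c => //; left.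
have P2 : passages D c.2 by exists c => //; right.
suff u s t : passages D t ->
    k' (arc_in D s) - k' (arc_out D t) = k (arc_in D s) - k (arc_out D t).
  rewrite /ucol -[right_to_left (mirror D) _ _]/(right_to_left D c.2 c.1).
  by case: ifP => _; exact: u.
move=> Pt; have eq4 (a b x y : int) : a - b = x - y -> a - x = b - y.
  move=> /eqP; rewrite subr_eq => /eqP ->.
  by rewrite addrAC [x - y]addrC addrK addrC.
(* [hk'] serves as a coloring of [D] by conversion, since [cheng_coloring] never reads
   [first_over]. *)
apply: eq4; rewrite (cheng_coloring_out hk hk' Pt).
by rewrite !(cheng_coloring_unique _ hk hk').
Qed.

(** Crossings and weights agree, so only exponents remain to be compared. They are compared as
    tagged values because the moduli of [p c] and [q c] are not convertible. *)
Lemma four_phases_mirror k k' (phi : exponent -> exponent)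
    (p : forall c, Rv `|degree D c|%N)
    (q : forall c, Rv `|degree (mirror D) c|%N) :
  cheng_coloring D k -> cheng_coloring (mirror D) k' ->
  (forall c, Tagged Rv (q c) = phi (Tagged Rv (p c))) ->
  four_phases k' q = freeg_map phi (four_phases k p).
Proof.
move=> hk hk' qp; rewrite /four_phases (raddf_fsum (freeg_map phi)); last first.
  exact: curve_finite.
apply: eq_fsbigr => c /set_mem Cc.
by rewrite [RHS]freeg_mapU -qp (ucol_mirror hk hk').
Qed.

End Mirror.

Theorem theorem4p3 (R : realType) (D : knotoid_diagram R)
    (k : nat -> int) (hk : cheng_coloring D k)
    (k' : nat -> int) (hk' : cheng_coloring (mirror D) k') :
  (B_fun (mirror D) k' = subst_xinv (subst_vinv (B_fun D k)) /\
   C_fun (mirror D) k' = C_fun D k) /\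
  (Bt_fun (mirror D) k' = subst_xinv (Bt_fun D k) /\
   Ct_fun (mirror D) k' = subst_vinv (Ct_fun D k)).
Proof.
have sC := @chords_from_to_sub R D.
have dE : degree (mirror D) = \- degree D by apply/funext/degree_mirror.
have iE : intersection_index (mirror D) = intersection_index D.
  exact/funext/intersection_index_mirror.
split; split.
- rewrite /subst_xinv /subst_vinv freeg_map_comp.
  apply: four_phases_mirror hk hk' _ => c; rewrite /g_poly /=.
  (* The degree changes sign both in the modulus, where [abszN] identifies the tags, and in the
     powers of [v], whence the substitution of v^-1. *)
  rewrite dE abszN r_chords_mirror l_chords_mirror; congr (Tagged Rv _).
  rewrite Rv_vinv_index_poly; try exact: sC.
  by apply: index_poly_mirror; exact: sC.
- rewrite -[RHS]freeg_map_id; apply: four_phases_mirror hk hk' _ => c.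
  rewrite /h_poly /= dE abszN rho_chords_mirror lambda_chords_mirror.
  (* Two minus signs cancel: one from the chord signs, one from exchanging the chord sets while
     negating the degree. *)
  rewrite -[index_poly D _ _ _ _]opprK -index_polyN; congr (Tagged Rv _).
  by apply: index_poly_mirror; exact: sC.
(* The powers of [v] are unchanged; the chord signs alone negate the exponent of [x]. *)
- apply: four_phases_mirror hk hk' _ => c; rewrite /gt_poly /= iE.
  rewrite degree_mirror abszN r_chords_mirror l_chords_mirror.
  by congr (Tagged Rv _); apply: index_poly_mirror; exact: sC.
- apply: four_phases_mirror hk hk' _ => c; rewrite /ht_poly /= iE.
  rewrite degree_mirror abszN rho_chords_mirror lambda_chords_mirror.
  (* The chord sets are exchanged but the invariant index is not negated, so the substitution of
     v^-1 has to supply that negation. *)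
  congr (Tagged Rv _); rewrite [LHS]index_poly_mirror; try exact: sC.
  rewrite Rv_vinv_index_poly; try exact: sC.
  by rewrite -index_polyN.
Qed.
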